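(* Let $\mathcal Y$ be a set of random variables, and let $\mathcal M$ be a set of mutually independent random variables (not necessarily independent of $\mathcal Y$). If $\mathcal Y_1,\mathcal Y_2\subseteq\mathcal Y$ and $\mathcal M_1,\mathcal M_2\subseteq\mathcal M$, then $$H(\mathcal Y_1\mid\mathcal M_1)+H(\mathcal Y_2\mid\mathcal M_2)\ \ge\ H(\mathcal Y_1\cup\mathcal Y_2\mid\mathcal M_1\cup\mathcal M_2)+H(\mathcal Y_1\cap\mathcal Y_2\mid\mathcal M_1\cap\mathcal M_2).$$
   Context: All random variables are defined on a common probability space and are discrete with finite entropy; the sets $\mathcal Y$ and $\mathcal M$ are finite. For a set of random variables $\mathcal A$, $H(\mathcal A\mid\mathcal B)$ denotes the Shannon conditional entropy of the joint tuple of the variables in $\mathcal A$ given the joint tuple of the variables in $\mathcal B$ (with $H(\emptyset\mid\mathcal B)=0$). Unions and intersections are of sets of (labelled) random variables. *)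

(* Defs.v *)
From HB Require Import structures.
From mathcomp Require Import all_boot all_order all_algebra.
From mathcomp Require Import all_classical all_reals all_analysis.

Set Implicit Arguments.
Unset Strict Implicit.
Unset Printing Implicit Defensive.

Import Order.TTheory GRing.Theory Num.Theory.
Import numFieldNormedType.Exports.

Local Open Scope classical_set_scope.
Local Open Scope ring_scope.
Local Open Scope ereal_scope.

(* Entropies are measured in nats; another base only rescales every entropy by
   the same positive factor. Since [ln 0 = 0], null values contribute 0.
   [\esum] is the unconditional sum of nonnegative extended reals; for [p] with
   values in [0, 1] the entropy is thus defined in [0, +oo], and it is [+oo]
   when the sum diverges. *)
Definition pmf_entropy (R : realType) (A : choiceType) (p : A -> R) : \bar R :=
  \esum_(u in [set: A]) (- (p u * ln (p u)))%R%:E.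

Section entropy.
Context (d : measure_display) (T : measurableType d) (R : realType).
Variable P : probability T R.

(* The library's [pmf] is restricted to real-valued random variables. *)
Definition mass (A : choiceType) (U : T -> A) (u : A) : R :=
  fine (P (U @^-1` [set u])).

Definition entropy (A : choiceType) (U : T -> A) : \bar R :=
  pmf_entropy (mass U).

Definition cond_mass (A B : choiceType) (U : T -> A) (V : T -> B) (v : B)
    (u : A) : R :=
  (mass (fun w => (U w, V w)) (u, v) / mass V v)%R.

(* H(U | V) = \sum_v P(V = v) H(U | V = v), the terms with P(V = v) = 0
   being 0. *)
Definition cond_entropy (A B : choiceType) (U : T -> A) (V : T -> B) : \bar R :=
  \esum_(v in [set: B]) ((mass V v)%:E * pmf_entropy (cond_mass U V v)).

Section families.
Context (I : finType) (dE : I -> measure_display)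
  (E : forall i, measurableType (dE i)).
Variable X : forall i, {dRV P >-> E i}.

(* The tuple of the variables with label in [A]; for [A = set0] it takes its
   values in a one-point type. *)
Definition joint (A : {set I}) (w : T) :
    {dffun forall i : {i : I | i \in A}, E (val i)} :=
  [ffun i : {i : I | i \in A} => X (val i) w].

Definition mutually_independent : Prop :=
  forall (S : {set I}) (B : forall i, set (E i)),
    (forall i, measurable (B i)) ->
    P (\bigcap_(i in [set` S]) (X i @^-1` B i)) =
    \prod_(i in S) P (X i @^-1` B i).

End families.

End entropy.

(* Main.v *)
(* Write [p_X w] for the probability that [X] takes the value [X w]. A
   conditional entropy H(U | V) is the mean of [- ln (p_(U,V) / p_V)], and each
   of the four here can be computed over the values of the joint tuple
   C = (Y1 :|: Y2, M1 :|: M2). Put A = (Y1, M1), B = (Y2, M2) and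
   D = (Y1 :&: Y2, M1 :&: M2). Independence gives, at every outcome,
   [p_M1 * p_M2 = p_(M1 :|: M2) * p_(M1 :&: M2)], so the four logarithms combine
   to [ln g] with [g = p_A * p_B / (p_C * p_D)]. Since [ln g <= g - 1], it is
   enough that [g] has mean at most 1: as C amounts to the pair (A, B), this
   mean is at most \sum_a p_A(a) / p_D(a) * \sum_b p_B(b), where b ranges over
   the values giving the same value of D as a, and the inner sum is p_D(a).
   Moving the negative terms across keeps every summand nonnegative, so the sums
   may be infinite. *)

Require Import Defs.
From mathcomp Require Import all_boot all_order all_algebra.
From mathcomp Require Import all_classical all_reals all_analysis.
From mathcomp Require Import lra.

Set Implicit Arguments.
Unset Strict Implicit.
Unset Printing Implicit Defensive.

Import Order.TTheory GRing.Theory Num.Theory.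

Local Open Scope classical_set_scope.
Local Open Scope ring_scope.
Local Open Scope ereal_scope.

(** * Sums of nonnegative extended reals *)

Lemma esumZl (R : realType) (A : choiceType) (S : set A) (k : R)
    (a : A -> \bar R) :
  (0 <= k)%R -> (forall i, 0 <= a i) ->
  \esum_(i in S) (k%:E * a i) = k%:E * \esum_(i in S) a i.
Proof.
move=> k0 a0; rewrite /esum -ereal_supZl//; last first.
  by apply/set0P; exists 0; exists set0; [exact: fsets_set0|rewrite fsbig_set0].
congr ereal_sup; apply/seteqP; split => x /=.
- move=> [X SX <-]; exists (\sum_(i \in X) a i); first by exists X.
  by rewrite ge0_mule_fsumr.
- by move=> [_ [X SX <-] <-]; exists X => //; rewrite ge0_mule_fsumr.
Qed.

Lemma le_esum_subset (R : realType) (A : choiceType) (S S' : set A)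
    (a : A -> \bar R) :
  S `<=` S' -> (forall i, S' i -> 0 <= a i) ->
  \esum_(i in S) a i <= \esum_(i in S') a i.
Proof.
move=> SS' a0; apply: ge_ereal_sup => _ [X [finX XS] <-].
by apply: ereal_sup_ubound; exists X => //; split => //;
  exact: subset_trans SS'.
Qed.

(** * Discrete random variables and sums over their values *)

Section discrete.
Context (d : measure_display) (T : measurableType d) (R : realType).
Variable P : probability T R.

(** The value type carries no sigma-algebra, so measurability is imposed on the fibres. *)
Definition discrete (A : choiceType) (U : T -> A) : Prop :=
  countable (range U) /\ forall u, measurable (U @^-1` [set u]).

(** This says that [V] is a function of [U] without naming the function. *)
Definition determines (A B : Type) (U : T -> A) (V : T -> B) : Prop :=
  forall w w', U w = U w' -> V w = V w'.

(** When [U] determines [V], the function carrying [U] to [V] is [V \o s]. Off the range of [U], [s]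
    is arbitrary; masses vanish there. *)
Definition section_of (A : Type) (U : T -> A) (s : A -> T) : Prop :=
  forall w, U (s (U w)) = U w.

Lemma exists_section (A : Type) (U : T -> A) : exists s, section_of U s.
Proof.
(* A default outcome exists because the total probability is 1. *)
have [w0 _] : [set: T] !=set0.
  apply/set0P/eqP => T0; have := probability_setT P.
  by rewrite T0 measure0 => /eqP; rewrite eqe eq_sym oner_eq0.
exists (fun u => xget w0 (U @^-1` [set u])) => w.
by have := @xgetPex _ w0 (U @^-1` [set U w]); apply; exists w.
Qed.

Lemma mass_ge0 (A : choiceType) (U : T -> A) u : (0 <= mass P U u)%R.
Proof. exact/fine_ge0/measure_ge0. Qed.

Lemma mass_out (A : choiceType) (U : T -> A) u :
  ~ range U u -> mass P U u = 0%R.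
Proof.
move=> Uu; rewrite /mass (_ : _ @^-1` _ = set0) ?measure0//.
by apply/seteqP; split => // w /= Uw; apply: Uu; exists w.
Qed.

(* The library's countable additivity is indexed by [nat], hence the
   enumeration [f] of the range. *)
Lemma bigcup_fibers (A : Type) (U : T -> A) (S : set A) (f : A -> nat) :
  {in range U &, injective f} ->
  U @^-1` S = \bigcup_(n in f @` (range U `&` S))
    ((f \o U) @^-1` [set n]).
Proof.
move=> finj; apply/seteqP; split => [w Sw|w [_ [u [[w' _ Uw'] Su] <-]] /= fE].
  by exists (f (U w)) => //; exists (U w) => //; split => //; exists w.
suff -> : U w = u by [].
by apply: finj => //; rewrite inE; [exists w|exists w'].
Qed.

Lemma fiber_comp (A : Type) (U : T -> A) (f : A -> nat) u :
  {in range U &, injective f} -> range U u ->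
  (f \o U) @^-1` [set f u] = U @^-1` [set u].
Proof.
move=> finj [w' _ Uw']; apply/seteqP; split => w /= => [fE|->//].
by apply: finj => //; rewrite inE; [exists w|exists w'].
Qed.

Lemma measurable_preimage_discrete (A : choiceType) (U : T -> A) (S : set A) :
  discrete U -> measurable (U @^-1` S).
Proof.
move=> [/countable_injP[f finj] mU]; rewrite (bigcup_fibers S finj).
by apply: bigcup_measurable => _ [u [Uu _] <-]; rewrite fiber_comp.
Qed.

Lemma probability_preimage (A : choiceType) (U : T -> A) (S : set A) :
  discrete U -> P (U @^-1` S) = \esum_(u in S) (mass P U u)%:E.
Proof.
move=> [/countable_injP[f finj] mU]; rewrite (bigcup_fibers S finj).
rewrite measure_bigcup; last 2 first.
- by move=> _ [u [Uu _] <-]; rewrite fiber_comp.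
- by move=> m n _ _ [w [/= <- <-]].
rewrite nneseries_esum// set_mem_set esum_image; last first.
  by move=> u v; rewrite !inE => -[? _] [? _]; apply: finj; rewrite inE.
rewrite esum_mkcondl; apply: eq_esum => u _; case: ifPn => [|/negP].
  rewrite inE => Uu; rewrite fiber_comp// /mass fineK//.
  exact: fin_num_measure.
by rewrite inE => Uu; rewrite mass_out.
Qed.

Lemma esum_mass (A : choiceType) (U : T -> A) :
  discrete U -> \esum_(u in [set: A]) (mass P U u)%:E = 1.
Proof.
by move=> dU; rewrite -probability_preimage// preimage_setT probability_setT.
Qed.

(** Since [V] factors as [(V \o s) \o U], its range is an image of that of [U], and its fibres are
    preimages under [U]. *)
Lemma determines_discrete (A B : choiceType) (U : T -> A) (V : T -> B) :
  discrete U -> determines U V -> discrete V.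
Proof.
move=> dU UV; have [s sU] := exists_section U.
have VE w : V w = V (s (U w)) by apply: UV; rewrite sU.
split.
  apply: sub_countable (proj1 dU).
  apply: card_le_trans (card_image_le (V \o s) _).
  by apply: subset_card_le => _ [w _ <-]; exists (U w);
    [exists w|rewrite /= -VE].
move=> v; rewrite (_ : _ @^-1` _ = U @^-1` [set u | V (s u) = v]).
  exact: measurable_preimage_discrete.
by apply/seteqP; split => w /=; rewrite -VE.
Qed.

Lemma mass_fineK (A : choiceType) (U : T -> A) u :
  discrete U -> (mass P U u)%:E = P (U @^-1` [set u]).
Proof. by move=> [_ mU]; rewrite /mass fineK//; exact: fin_num_measure. Qed.

Lemma le_mass (A B : choiceType) (U : T -> A) (V : T -> B) w :
  discrete U -> determines U V -> (mass P U (U w) <= mass P V (V w))%R.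
Proof.
move=> dU UV; have dV := determines_discrete dU UV.
rewrite -lee_fin !mass_fineK//; apply: le_measure; rewrite ?inE.
- exact: (proj2 dU).
- exact: (proj2 dV).
- by move=> w' /= /UV.
Qed.

(** Both sides are the mean of [phi] at [V]: each fibre of [V] splits into fibres of [U], and the
    pairs [(v, u)] with [V (s u) = v] are indexed by [u] alone. *)
Lemma esum_mass_determines (A B : choiceType) (U : T -> A) (V : T -> B)
    (s : A -> T) (phi : B -> R) :
  discrete U -> determines U V -> section_of U s ->
  (forall v, (0 <= phi v)%R) ->
  \esum_(v in [set: B]) (mass P V v * phi v)%:E =
  \esum_(u in [set: A]) (mass P U u * phi (V (s u)))%:E.
Proof.
move=> dU UV sU phi0; have dV := determines_discrete dU UV.
under eq_esum => v _.
  rewrite mulrC EFinM mass_fineK//.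
  rewrite (_ : V @^-1` _ = U @^-1` [set u | V (s u) = v]); last first.
    by apply/seteqP; split => w /=; rewrite (UV (s (U w)) w (sU w)).
  rewrite probability_preimage// -esumZl//; last first.
    by move=> u; rewrite lee_fin mass_ge0.
  over.
rewrite esum_esum; last by move=> *; rewrite lee_fin mulr_ge0 ?mass_ge0.
rewrite (@reindex_esum _ _ _ [set: A] _ (fun u => (V (s u), u))).
  by apply: eq_esum => u _ /=; rewrite mulrC.
split => //.
- by move=> u u' _ _ [].
- by move=> [v u] [_ /= <-]; exists u.
Qed.

(** * Conditional entropy as a single sum *)

Lemma neg_ln_cond_mass_ge0 (A B : choiceType) (U : T -> A) (V : T -> B) x :
  discrete (fun w => (U w, V w)) ->
  (0 <= - ln (mass P (fun w => (U w, V w)) x / mass P V x.2))%R.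
Proof.
move=> dUV; rewrite oppr_ge0 ln_le0//.
have [[w _ <-]|n] := pselect (range (fun w => (U w, V w)) x); last first.
  by rewrite (mass_out n) mul0r.
have [->|V0] := eqVneq (mass P V (U w, V w).2) 0%R.
  by rewrite invr0 mulr0.
rewrite ler_pdivrMr ?lt0r ?V0 ?mass_ge0// mul1r.
by apply: (le_mass w dUV) => ? ? [].
Qed.

Lemma cond_entropyE (A B : choiceType) (U : T -> A) (V : T -> B) :
  discrete (fun w => (U w, V w)) ->
  cond_entropy P U V = \esum_(x in [set: A * B])
    (mass P (fun w => (U w, V w)) x *
     - ln (mass P (fun w => (U w, V w)) x / mass P V x.2))%:E.
Proof.
move=> dUV; rewrite /cond_entropy /pmf_entropy.
have UVV : determines (fun w => (U w, V w)) V by move=> w w' [].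
have ent_ge0 v u :
    0 <= (- (cond_mass P U V v u * ln (cond_mass P U V v u)))%:E.
  rewrite lee_fin -mulrN mulr_ge0 ?divr_ge0 ?mass_ge0//.
  exact: (neg_ln_cond_mass_ge0 (u, v)).
under eq_esum do rewrite -esumZl ?mass_ge0//.
rewrite esum_esum; last by move=> *; rewrite mule_ge0// lee_fin mass_ge0.
rewrite (@reindex_esum _ _ _ [set: A * B] _ (fun x => (x.2, x.1))).
  apply: eq_esum => -[u v] _ /=; rewrite -EFinM; congr EFin.
  rewrite /cond_mass.
  have [[w _ [<- <-]]|n] := pselect (range (fun w => (U w, V w)) (u, v)).
    have := le_mass w dUV UVV.
    (* A null value of [V] makes the joint mass null too; otherwise the weight [mass P V v] cancels
       the denominator of [cond_mass]. *)
    have [->|V0 _] := eqVneq (mass P V (V w)) 0%R.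
      move=> le0.
      suff -> : mass P (fun w => (U w, V w)) (U w, V w) = 0%R.
        by rewrite !mul0r.
      by apply/eqP; rewrite eq_le le0 mass_ge0.
    by rewrite mulrN mulrA mulrCA mulfV// mulr1 mulrN.
  by rewrite (mass_out n) !(mul0r, oppr0, mulr0).
split => //.
- by move=> [u v] [u' v'] _ _ /= [-> ->].
- by move=> [v u] _; exists (u, v).
Qed.

(** This puts entropies of different variables over one index set, the values of [W], so that they
    can be compared term by term. *)
Lemma cond_entropy_determines (A B C : choiceType) (U : T -> A) (V : T -> B)
    (W : T -> C) (s : C -> T) :
  discrete W -> determines W (fun w => (U w, V w)) -> section_of W s ->
  cond_entropy P U V = \esum_(c in [set: C]) (mass P W c *
    - ln (mass P (fun w => (U w, V w)) (U (s c), V (s c)) /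
          mass P V (V (s c))))%:E.
Proof.
move=> dW WUV sW; have dUV := determines_discrete dW WUV.
rewrite cond_entropyE// (esum_mass_determines (phi := fun x =>
  (- ln (mass P (fun w => (U w, V w)) x / mass P V x.2))%R) dW WUV sW)//.
by move=> x; exact: neg_ln_cond_mass_ge0.
Qed.

End discrete.

(** * Submodularity of conditional entropy *)

Lemma ln_ratio_bound (R : realType) (a b c e p q r t : R) :
  (0 < a)%R -> (0 < b)%R -> (0 < c)%R -> (0 < e)%R ->
  (0 < p)%R -> (0 < q)%R -> (0 < r)%R -> (0 < t)%R -> (p * q = r * t)%R ->
  (- ln (c / r) + - ln (e / t) + 1 <=
   - ln (a / p) + - ln (b / q) + a * b / (c * e))%R.
Proof.
move=> a0 b0 c0 e0 p0 q0 r0 t0 pq.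
have /(congr1 (@ln R)) := pq; rewrite (lnM p0 q0) (lnM r0 t0) => lnpq.
have x0 : (0 < a * b / (c * e))%R by rewrite divr_gt0// mulr_gt0.
(* This is [ln x <= x - 1] at [x = a * b / (c * e)]; the logarithms of [p], [q], [r], [t] cancel by
   [lnpq]. *)
have := @le_ln1Dx R (a * b / (c * e) - 1)%R.
rewrite ltrBDl subrr addrCA subrr addr0 => /(_ x0).
rewrite (ln_div c0 r0) (ln_div e0 t0) (ln_div a0 p0) (ln_div b0 q0).
rewrite (ln_div (mulr_gt0 a0 b0) (mulr_gt0 c0 e0)) (lnM a0 b0) (lnM c0 e0).
lra.
Qed.

Section submodularity.
Context (d : measure_display) (T : measurableType d) (R : realType).
Variable P : probability T R.

Lemma esum_mass_ratio_le1 (A B C D : choiceType)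
    (U : T -> A) (V : T -> B) (W : T -> C) (Z : T -> D) (s : C -> T) :
  discrete W -> section_of W s ->
  determines W (fun w => (U w, V w)) -> determines (fun w => (U w, V w)) W ->
  determines U Z -> determines V Z ->
  \esum_(c in [set: C]) (mass P W c *
    (mass P U (U (s c)) * mass P V (V (s c)) /
     (mass P W (W (s c)) * mass P Z (Z (s c)))))%:E <= 1.
Proof.
move=> dW sW WUV UVW UZ VZ.
have WU : determines W U by move=> w w' /WUV [].
have WV : determines W V by move=> w w' /WUV [].
have dU := determines_discrete P dW WU.
have dV := determines_discrete P dW WV.
have dZ := determines_discrete P dU UZ.
have [sU sUE] := exists_section P U.
have [sV sVE] := exists_section P V.
have ZU w : Z (sU (U w)) = Z w by exact/UZ/sUE.
have ZV w : Z (sV (V w)) = Z w by exact/VZ/sVE.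
pose k u := (mass P U u / mass P Z (Z (sU u)))%R.
have k0 u : (0 <= k u)%R by rewrite divr_ge0 ?mass_ge0.
(* The values of [V] that give [Z] the same value as [u] does; their total mass is that of [Z] at
   this value. *)
pose J u := [set v | Z (sV v) = Z (sU u)].
have a0 u v : 0 <= (k u)%:E * (mass P V v)%:E.
  by rewrite mule_ge0 ?lee_fin ?mass_ge0.
apply: (@le_trans _ _
    (\esum_(c in range W) ((k (U (s c)))%:E * (mass P V (V (s c)))%:E))).
  rewrite [leRHS]esum_mkcond; apply: le_esum => c _.
  case: ifPn => [/set_mem Wc|]; last first.
    by rewrite notin_setE => Wc; rewrite mass_out// mul0r.
  have Wsc : W (s c) = c by case: Wc => w _ <-; rewrite sW.
  rewrite Wsc -EFinM lee_fin /k ZU.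
  (* If [c] is null, the left term is 0 and the right one may be positive; otherwise the two are
     equal. *)
  have [->|W0] := eqVneq (mass P W c) 0%R.
    by rewrite mul0r mulr_ge0 ?mass_ge0// divr_ge0 ?mass_ge0.
  by rewrite invfM mulrCA [in X in (_ * X)%R]mulrA mulfV// mul1r mulrAC.
(* On the range of [W], [c] is recovered from the values of [U] and [V], so the sum runs over
   distinct pairs, all compatible through [J]. *)
rewrite -(@esum_image _ _ _ _ (fun c => (U (s c), V (s c)))
   (fun x => (k x.1)%:E * (mass P V x.2)%:E)); last first.
  move=> c c'; rewrite !inE => -[w _ <-] [w' _ <-] /(UVW (s _) (s _)).
  by rewrite !sW.
apply: (@le_trans _ _ (\esum_(x in [set: A] `*`` J)
    ((k x.1)%:E * (mass P V x.2)%:E))).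
  apply: le_esum_subset => // _ [_ [w _ <-] <-]; split => //=.
  by rewrite /J /= ZU ZV.
rewrite -(@esum_esum _ _ _ _ J
  (fun u v => (k u)%:E * (mass P V v)%:E))//.
rewrite -(esum_mass P dU); apply: le_esum => u _.
rewrite esumZl//; last by move=> v; rewrite lee_fin mass_ge0.
rewrite -probability_preimage//.
rewrite (_ : _ @^-1` _ = Z @^-1` [set Z (sU u)]); last first.
  by apply/seteqP; split => w; rewrite /J /= ZV.
rewrite -mass_fineK// -EFinM lee_fin /k.
have [->|Z0] := eqVneq (mass P Z (Z (sU u))) 0%R.
  by rewrite mulr0 mass_ge0.
by rewrite divfK.
Qed.

(** Independence enters only through the product identity for the masses of the conditioning
    variables; unions and intersections enter only through [determines]. *)
Lemma cond_entropy_submodular (A1 B1 A2 B2 A3 B3 A4 B4 : choiceType)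
    (U1 : T -> A1) (V1 : T -> B1) (U2 : T -> A2) (V2 : T -> B2)
    (U : T -> A3) (V : T -> B3) (U' : T -> A4) (V' : T -> B4) :
  let X1 w := (U1 w, V1 w) in let X2 w := (U2 w, V2 w) in
  let W w := (U w, V w) in let Z w := (U' w, V' w) in
  discrete W ->
  determines W (fun w => (X1 w, X2 w)) ->
  determines (fun w => (X1 w, X2 w)) W ->
  determines X1 Z -> determines X2 Z ->
  (forall w, mass P V1 (V1 w) * mass P V2 (V2 w) =
    mass P V (V w) * mass P V' (V' w))%R ->
  cond_entropy P U V + cond_entropy P U' V' <=
  cond_entropy P U1 V1 + cond_entropy P U2 V2.
Proof.
move=> X1 X2 W Z dW WX XW X1Z X2Z massV.
have WX1 : determines W X1 by move=> w w' /WX /(congr1 fst).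
have WX2 : determines W X2 by move=> w w' /WX /(congr1 snd).
have WZ : determines W Z by move=> w w' /WX1 /X1Z.
have WV1 : determines W V1 by move=> w w' /WX1 [].
have WV2 : determines W V2 by move=> w w' /WX2 [].
have WV : determines W V by move=> w w' [].
have WV' : determines W V' by move=> w w' /WZ [].
have [s sW] := exists_section P W.
have f0 (A B : choiceType) (F : T -> A) (G : T -> B) w :
    determines W (fun w => (F w, G w)) ->
    (0 <= - ln (mass P (fun w => (F w, G w)) (F w, G w) / mass P G (G w)))%R.
  by move=> WFG; exact/neg_ln_cond_mass_ge0/(determines_discrete P dW).
rewrite (cond_entropy_determines P dW WX1 sW).
rewrite (cond_entropy_determines P dW WX2 sW).
rewrite (cond_entropy_determines P dW _ sW)//.
rewrite (cond_entropy_determines P dW WZ sW).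
have q0 c x : (0 <= x)%R -> 0 <= (mass P W c * x)%:E.
  by move=> x0; rewrite lee_fin mulr_ge0 ?mass_ge0.
rewrite -!esumD; try by move=> c _; apply/q0/f0.
(* The added 1 becomes the total mass of [W] on the left, while on the right it is bounded below by
   the mean of the ratio. What remains is [ln_ratio_bound] weighted by [mass P W c]. *)
rewrite -(leeD2rE (x := 1))//.
apply: (@le_trans _ _ (_ + \esum_(c in [set: A3 * B3]) (mass P W c *
    (mass P X1 (X1 (s c)) * mass P X2 (X2 (s c)) /
     (mass P W (W (s c)) * mass P Z (Z (s c)))))%:E)); last first.
  by apply: leeD2l; exact: esum_mass_ratio_le1.
rewrite -(esum_mass P dW) -!esumD; last 4 first.
- by move=> c _; rewrite adde_ge0 ?q0 ?f0.
- by move=> c _; rewrite q0// divr_ge0 ?mulr_ge0 ?mass_ge0.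
- by move=> c _; rewrite adde_ge0 ?q0 ?f0.
- by move=> c _; rewrite lee_fin mass_ge0.
apply: le_esum => c _; rewrite -!EFinD lee_fin.
have [->|c0] := eqVneq (mass P W c) 0%R; first by rewrite !mul0r !addr0.
have Wsc : W (s c) = c.
  have [[w _ <-]|n] := pselect (range W c); first exact: sW.
  by rewrite (mass_out P n) eqxx in c0.
rewrite -[X in (_ + _ + X <= _)%R]mulr1 -!mulrDr ler_wpM2l ?mass_ge0//.
(* Any variable determined by [W] has at [s c] a mass at least that of [c], so every logarithm and
   quotient is taken at positive arguments. *)
have {c0}Ppos (A : choiceType) (F : T -> A) :
    determines W F -> (0 < mass P F (F (s c)))%R.
  move=> WF; apply: lt_le_trans (le_mass P _ dW WF).
  by rewrite Wsc lt_neqAle eq_sym c0 mass_ge0.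
by apply: ln_ratio_bound; rewrite ?massV//; exact: Ppos.
Qed.

End submodularity.

(** * Joint tuples of finite families *)

Section families.
Context (d : measure_display) (T : measurableType d) (R : realType).
Variable P : probability T R.

Lemma discrete_pair (A B : choiceType) (U : T -> A) (V : T -> B) :
  discrete U -> discrete V -> discrete (fun w => (U w, V w)).
Proof.
move=> [cU mU] [cV mV]; split.
  apply: sub_countable (countableX cU cV); apply: subset_card_le.
  by move=> _ [w _ <-]; split; exists w.
move=> [u v]; rewrite (_ : _ @^-1` _ = U @^-1` [set u] `&` V @^-1` [set v]).
  exact: measurableI.
by apply/seteqP; split => w /= [-> ->].
Qed.

Context (I : finType) (dE : I -> measure_display)
  (E : forall i, measurableType (dE i)).
Variable X : forall i, {dRV P >-> E i}.

Lemma joint_eqP (S : {set I}) w w' :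
  joint X S w = joint X S w' <-> forall i, i \in S -> X i w = X i w'.
Proof.
split=> [eqX i Si|eqX].
  by have := congr1 (fun u : {dffun _} => u (exist _ i Si)) eqX; rewrite !ffunE.
by apply/ffunP => i; rewrite !ffunE; exact/eqX/valP.
Qed.

Hypothesis E_singletons : forall (i : I) (x : E i), measurable [set x].

Lemma measurable_fiber i (x : E i) : measurable (X i @^-1` [set x]).
Proof. by rewrite -[_ @^-1` _]setTI; exact: measurable_funP. Qed.

Lemma discrete_joint (S : {set I}) : discrete (joint X S).
Proof.
split=> [|u]; last first.
  rewrite (_ : _ @^-1` _ = \bigcap_(i in [set: {i : I | i \in S}])
      (X (val i) @^-1` [set u i])).
    apply: fin_bigcap_measurable => [|i _]; first exact: finite_finset.
    exact: measurable_fiber.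
  apply/seteqP; split => [w <- i _|w Xw]; first by rewrite /= ffunE.
  by apply/ffunP => i; rewrite ffunE; exact: Xw.
have cX i : {g : E i -> nat | {in range (X i) &, injective g}}.
  by apply/cid/countable_injP; exact: countable_range.
apply/countable_injP.
(* Coding each coordinate by a natural number turns the tuple into a finite function to [nat], which
   [choice.pickle] codes by one number. *)
exists (fun u : {dffun forall i : {i : I | i \in S}, E (val i)} =>
  choice.pickle [ffun i : {i : I | i \in S} => sval (cX (val i)) (u i)]).
move=> _ _ /set_mem[w _ <-] /set_mem[w' _ <-].
move=> /(pcan_inj choice.pickleK)/ffunP eqg.
apply/ffunP => i; have := eqg i; rewrite !ffunE.
by apply: (svalP (cX (val i))); rewrite inE; eexists.
Qed.

(** A fibre of the tuple is the intersection of the fibres of its coordinates, so independence is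
    applied to singletons. *)
Lemma mass_joint_independent (S : {set I}) w : mutually_independent X ->
  mass P (joint X S) (joint X S w) = (\prod_(i in S) mass P (X i) (X i w))%R.
Proof.
move=> indX; apply: EFin_inj; rewrite mass_fineK; last exact: discrete_joint.
rewrite -prodEFin.
rewrite (_ : _ @^-1` _ =
    \bigcap_(i in [set` S]) (X i @^-1` [set X i w])); last first.
  by apply/seteqP; split => w' /=; rewrite joint_eqP.
rewrite (indX S (fun i => [set X i w])) => [|i]; last exact: E_singletons.
apply: eq_bigr => i _; rewrite /mass fineK//.
by apply: fin_num_measure; exact: measurable_fiber.
Qed.

End families.

Theorem proposition3 (R : realType) (d : measure_display)
    (T : measurableType d) (P : probability T R)
    (I : finType) (dE : I -> measure_display)
    (E : forall i, measurableType (dE i))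
    (J : finType) (dF : J -> measure_display)
    (F : forall j, measurableType (dF j))
    (Y : forall i, {dRV P >-> E i}) (M : forall j, {dRV P >-> F j})
    (E_singletons : forall (i : I) (x : E i), measurable [set x])
    (F_singletons : forall (j : J) (x : F j), measurable [set x])
    (Y_finite : forall i, entropy P (Y i) < +oo)
    (M_finite : forall j, entropy P (M j) < +oo)
    (M_independent : mutually_independent M)
    (Y1 Y2 : {set I}) (M1 M2 : {set J}) :
  cond_entropy P (joint Y Y1) (joint M M1) +
  cond_entropy P (joint Y Y2) (joint M M2) >=
  cond_entropy P (joint Y (Y1 :|: Y2)) (joint M (M1 :|: M2)) +
  cond_entropy P (joint Y (Y1 :&: Y2)) (joint M (M1 :&: M2)).
Proof.
have pairE (A B : choiceType) (a a' : A) (b b' : B) :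
  (a, b) = (a', b') <-> a = a' /\ b = b' by split=> [[]|[-> ->]].
apply: cond_entropy_submodular.
- by apply: discrete_pair; exact: discrete_joint.
- move=> w w' /pairE[/joint_eqP eqY /joint_eqP eqM].
  do !(apply/pairE; split); apply/joint_eqP => i Si;
    by [apply: eqY; rewrite inE Si ?orbT | apply: eqM; rewrite inE Si ?orbT].
- move=> w w' /pairE[/pairE[/joint_eqP Y1E /joint_eqP M1E]].
  move=> /pairE[/joint_eqP Y2E /joint_eqP M2E].
  apply/pairE; split; apply/joint_eqP => i; rewrite inE => /orP[].
  + exact: Y1E.
  + exact: Y2E.
  + exact: M1E.
  + exact: M2E.
- move=> w w' /pairE[/joint_eqP YE /joint_eqP ME].
  apply/pairE; split; apply/joint_eqP => i; rewrite inE => /andP[S1 S2];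
    by [exact: YE | exact: ME].
- move=> w w' /pairE[/joint_eqP YE /joint_eqP ME].
  apply/pairE; split; apply/joint_eqP => i; rewrite inE => /andP[S1 S2];
    by [exact: YE | exact: ME].
- move=> w; rewrite !mass_joint_independent//.
  (* All products are extended to every label with factor 1 elsewhere. Each label then contributes
     equally to both sides, since it lies in [M1] and [M2] as often as in their union and
     intersection. *)
  rewrite ![(\prod_(_ in _) _)%R]big_mkcond -!big_split/=.
  apply: eq_bigr => j _; rewrite !inE.
  by case: (j \in M1); case: (j \in M2); rewrite /= ?mulr1 ?mul1r.
Qed.
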